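(* For all integers $k,n\ge1$, \[ C_{k,n} \;=\; \sum_{\substack{\lambda\subseteq(k-1)^n \\ |\lambda|<n }} \frac{n-|\lambda|}{n}\, m_\lambda(1^n) \;=\; \sum_{0\le j\le (n-1)/k} \frac{(-1)^j}{n} \binom{n}{j} \binom{2n-jk}{n+1}. \]
   Context: A binary tree is a rooted plane tree in which every node has either $0$ or $2$ (ordered) children; nodes with no children are leaves. For $n\ge0$ let $\mathcal T_n$ be the set of binary trees with $n+1$ leaves. For binary trees $s,t$, $s\wedge t$ is the binary tree whose root has left subtree $s$ and right subtree $t$; iterated $\wedge$ is read left to right, $t_0\wedge t_1\wedge\cdots\wedge t_j=(\cdots((t_0\wedge t_1)\wedge t_2)\cdots)\wedge t_j$. Fix $k\ge1$. If $t\in\mathcal T_n$ has, rooted at some node, a maximal subtree of the form $(t_0\wedge t_1\wedge\cdots\wedge t_k)\wedge t_{k+1}$ (the $t_i$ binary trees), replacing it by $t_0\wedge(t_1\wedge\cdots\wedge t_{k+1})$ gives a tree in $\mathcal T_n$; this is a right $k$-rotation, its inverse a left $k$-rotation. Two trees of $\mathcal T_n$ are $k$-equivalent if one is obtained from the other by a finite sequence of left/right $k$-rotations. The modular Catalan number $C_{k,n}$ is the number of $k$-equivalence classes of $\mathcal T_n$ (equivalently, the number of classes of parenthesizations of $x_0*\cdots*x_n$ modulo the law $(x_0*\cdots*x_k)*x_{k+1}=x_0*(x_1*\cdots*x_{k+1})$, products read left to right). A partition $\lambda\subseteq(k-1)^n$ is a sequence $\lambda_1\ge\cdots\ge\lambda_n\ge0$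 of integers with $\lambda_1\le k-1$; $|\lambda|=\lambda_1+\cdots+\lambda_n$; and $m_\lambda(1^n)$ (the monomial symmetric function evaluated at $x_1=\cdots=x_n=1$) equals the multinomial coefficient $n!/\prod_{i\ge0} m_i!$, where $m_i=\#\{j:\lambda_j=i\}$. *)

(* Defs.v *)
From HB Require Import structures.
From mathcomp Require Import all_boot all_order all_algebra.
From mathcomp Require Import mpoly.
From mathcomp.classical Require Import boolp.

Set Implicit Arguments.
Unset Strict Implicit.
Unset Printing Implicit Defensive.

Import GRing.Theory Num.Theory.

Inductive btree : Type := Leaf | Wedge of btree & btree.

Fixpoint nleaves (t : btree) : nat :=
  if t is Wedge l r then nleaves l + nleaves r else 1.

Fixpoint encode_btree (t : btree) : GenTree.tree unit :=
  if t is Wedge l r then GenTree.Node 0 [:: encode_btree l; encode_btree r]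
  else GenTree.Leaf tt.

Fixpoint decode_btree (g : GenTree.tree unit) : option btree :=
  match g with
  | GenTree.Leaf _ => Some Leaf
  | GenTree.Node _ [:: gl; gr] =>
      if decode_btree gl is Some l then
        if decode_btree gr is Some r then Some (Wedge l r) else None
      else None
  | _ => None
  end.

Lemma encode_btreeK : pcancel encode_btree decode_btree.
Proof. by elim=> //= l -> r ->. Qed.

HB.instance Definition _ := Countable.copy btree (pcan_type encode_btreeK).

Record btree_of (n : nat) : Type :=
  BtreeOf { btree_val :> btree; _ : nleaves btree_val == n.+1 }.

HB.instance Definition _ n := [isSub for @btree_val n].
HB.instance Definition _ n := [Countable of btree_of n by <:].

Fixpoint btrees_upto (d : nat) : seq btree :=
  if d is d'.+1 then
    Leaf :: [seq Wedge l r | l <- btrees_upto d', r <- btrees_upto d']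
  else [:: Leaf].

Lemma nleaves_gt0 t : 0 < nleaves t.
Proof. by elim: t => //= l IHl r _; rewrite addn_gt0 IHl. Qed.

Lemma mem_btrees_upto d t : nleaves t <= d.+1 -> t \in btrees_upto d.
Proof.
elim: d t => [|d IHd] [|l r] //= le_lr; last first.
  rewrite inE /=; apply: allpairs_f; apply: IHd; rewrite -ltnS.
    by apply: leq_trans le_lr; rewrite -addn1 leq_add2l nleaves_gt0.
  by apply: leq_trans le_lr; rewrite -add1n leq_add2r nleaves_gt0.
have := leq_add (nleaves_gt0 l) (nleaves_gt0 r).
by move=> /leq_trans/(_ le_lr).
Qed.

Definition btree_of_enum n : seq (btree_of n) :=
  undup (pmap insub (btrees_upto n)).

Lemma btree_of_enumP n : Finite.axiom (btree_of_enum n).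
Proof.
apply: Finite.uniq_enumP; first exact: undup_uniq.
move=> t; rewrite mem_undup mem_pmap_sub /= mem_btrees_upto //.
by rewrite (eqP (valP t)).
Qed.

HB.instance Definition _ n := isFinite.Build (btree_of n) (@btree_of_enumP n).

(* wedges t i j is t_i /\ t_(i+1) /\ ... /\ t_(i+j), associated to the left. *)
Fixpoint wedges (t : nat -> btree) (i j : nat) : btree :=
  if j is j'.+1 then Wedge (wedges t i j') (t (i + j)) else t i.

Inductive right_rotation (k : nat) : btree -> btree -> Prop :=
| RotRoot (t : nat -> btree) :
    right_rotation k (Wedge (wedges t 0 k) (t k.+1))
                     (Wedge (t 0) (wedges t 1 k))
| RotLeft l l' r :
    right_rotation k l l' -> right_rotation k (Wedge l r) (Wedge l' r)
| RotRight l r r' :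
    right_rotation k r r' -> right_rotation k (Wedge l r) (Wedge l r').

Definition rotation (k n : nat) : rel (btree_of n) :=
  fun s t => `[< right_rotation k s t \/ right_rotation k t s >].

Definition k_equivalent (k n : nat) : rel (btree_of n) := connect (@rotation k n).

Definition modular_catalan (k n : nat) : nat :=
  #|equivalence_partition (@k_equivalent k n) [set: btree_of n]|.

(* For k >= 1, a partition contained in (k-1)^n is a weakly decreasing element
   of n.-tuple 'I_k. *)
Definition is_partition (k n : nat) (lam : n.-tuple 'I_k) : bool :=
  sorted geq (map val lam).

Definition part_size (k n : nat) (lam : n.-tuple 'I_k) : nat :=
  \sum_(i < n) tnth lam i.

Local Open Scope ring_scope.

(* The sum is over the distinct rearrangements a of lam. *)
Definition monomial_sym (k n : nat) (lam : n.-tuple 'I_k) : {mpoly rat[n]} :=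
  \sum_(a : n.-tuple 'I_k | perm_eq a lam)
     'X_[[multinom (tnth a i : nat) | i < n]].

Definition monomial_sym_ones (k n : nat) (lam : n.-tuple 'I_k) : rat :=
  (monomial_sym lam).@[fun _ => 1].

Lemma size_permutations_mult (T : finType) (s : seq T) :
  (size (permutations s) * \prod_(x : T) (count_mem x s)`! = (size s)`!)%N.
Proof.
have [m] := ubnP (size s); elim: m s => // m IHm s lt_s_m.
have [/size0nil -> | s_gt0] := posnP (size s); first by rewrite big1.
rewrite (perm_size (permutationsE s_gt0)) size_allpairs_dep sumnE big_map.
rewrite big_distrl /= -(prednK s_gt0) factS prednK //.
transitivity (\sum_(x <- undup s) count_mem x s * (size s).-1`!)%N; last first.
  rewrite -big_distrl /=; congr (_ * _)%N.
  rewrite -sum1_size -[RHS]big_undup_iterop_count; apply: eq_bigr => x _.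
  by rewrite Monoid.iteropE /= iter_addn_0 mul1n.
apply: eq_big_seq => x; rewrite mem_undup => s_x.
rewrite -(size_rem s_x) -IHm; last first.
  by rewrite size_rem // prednK.
rewrite mulnCA; congr (_ * _)%N.
rewrite (bigD1 x) //= [in RHS](bigD1 x) //= mulnA; congr (_ * _)%N.
  rewrite (permP (perm_to_rem s_x)) /= eqxx add1n factS.
  by [].
apply: eq_bigr => y /negPf y_x.
by rewrite (permP (perm_to_rem s_x)) /= eq_sym y_x.
Qed.

Lemma monomial_sym_onesE (k n : nat) (lam : n.-tuple 'I_k) :
  monomial_sym_ones lam = n`!%:R / (\prod_(i < k) (count_mem i lam)`!)%:R.
Proof.
have ->: monomial_sym_ones lam = (size (permutations lam))%:R.
  rewrite /monomial_sym_ones /monomial_sym rmorph_sum /=.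
  under eq_bigr => a _.
    rewrite mevalX big1; last by move=> i _; rewrite expr1n.
    over.
  rewrite sumr_const; congr (_%:R).
  rewrite cardE -(size_map val); apply: perm_size.
  apply: uniq_perm.
  - by rewrite map_inj_uniq ?enum_uniq //; apply: val_inj.
  - exact: permutations_uniq.
  move=> s; rewrite mem_permutations; apply/mapP/idP => [[a]|s_lam].
    by rewrite mem_enum => ? ->.
  have sz_s : size s == n by rewrite (perm_size s_lam) size_tuple.
  by exists (Tuple sz_s); rewrite ?mem_enum.
have := size_permutations_mult lam; rewrite size_tuple => <-.
rewrite natrM mulfK // pnatr_eq0 -lt0n.
by apply: prodn_gt0 => i; apply: fact_gt0.
Qed.

(* Main.v *)
(* Left spines turn a binary tree with n+1 leaves into a plane tree with n+1
   vertices. A tree is determined by the degrees of its n non-root vertices in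
   preorder, and the sequences so obtained are exactly those in which every
   nonempty suffix has sum smaller than its length. A k-rotation changes these
   degrees by multiples of k only, and left k-rotations, which terminate, bring
   all of them below k; so the classes are counted by the sequences of this
   kind with entries below k.  As in the cycle lemma, among all sequences of
   weight s a fraction (n - s) / n has the suffix property, which is the first
   formula. The sum over all sequences of (n - s)^+ is the coefficient of
   X^(n-1) in ((1 - X^k) / (1 - X))^n / (1 - X)^2, which is the second one. *)

Require Import Defs.
From mathcomp Require Import all_boot all_order all_algebra.
From mathcomp Require Import mpoly ring zify.
From mathcomp.classical Require Import boolp.

Set Implicit Arguments.
Unset Strict Implicit.
Unset Printing Implicit Defensive.

Import GRing.Theory Num.Theory.

(** * Degree sequences of plane trees *)

Fixpoint lspine (t : btree) : nat :=
  if t is Wedge l _ then (lspine l).+1 else 0.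

(* The degrees of the non-root vertices, in preorder, of the plane tree whose
   vertices are the leaves of [t] and where the children of the first leaf of
   t_0 /\ t_1 /\ ... /\ t_d (t_0 a leaf) are the roots of t_1, ..., t_d. *)
Fixpoint code (t : btree) : seq nat :=
  if t is Wedge l r then code l ++ lspine r :: code r else [::].

Fixpoint ballot (s : seq nat) : bool :=
  if s is x :: s' then (x + sumn s' <= size s') && ballot s' else true.

Lemma size_code t : (size (code t)).+1 = nleaves t.
Proof. by elim: t => //= l <- r <-; rewrite size_cat /= addSn !addnS. Qed.

(** [lspine t] is the degree of the root, and every non-root vertex is the child of exactly one
    vertex. *)
Lemma sumn_code t : lspine t + sumn (code t) = size (code t).
Proof. by elim: t => //= l IHl r IHr; rewrite sumn_cat size_cat /=; lia. Qed.

Lemma ballot_cat s1 s2 : ballot s1 -> ballot s2 -> ballot (s1 ++ s2).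
Proof.
move=> b1 b2.
have le_sumn s : ballot s -> sumn s <= size s.
  by case: s => //= x s /andP[le_x _]; apply: leq_trans le_x _.
elim: s1 b1 => //= x s1 IH /andP[le_x /[dup] b1 /IH ->]; rewrite andbT.
by rewrite sumn_cat size_cat addnA leq_add // le_sumn.
Qed.

Lemma ballot_code t : ballot (code t).
Proof.
elim: t => //= l IHl r IHr; apply: ballot_cat => //=.
by rewrite IHr sumn_code leqnn.
Qed.

Lemma ballot_modn k s : ballot s -> ballot [seq x %% k | x <- s].
Proof.
have le_sumn s' : sumn [seq x %% k | x <- s'] <= sumn s'.
  by elim: s' => //= x s' IH; rewrite leq_add ?leq_mod.
elim: s => //= x s IH /andP[le_x /IH ->]; rewrite andbT size_map.
by apply: leq_trans le_x; rewrite leq_add ?leq_mod.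
Qed.

Definition comb (us : seq btree) : btree := foldl Wedge Leaf us.

Fixpoint spine (t : btree) : seq btree :=
  if t is Wedge l r then rcons (spine l) r else [::].

Lemma spineK t : comb (spine t) = t.
Proof. by rewrite /comb; elim: t => //= l IHl r _; rewrite foldl_rcons IHl. Qed.

Lemma size_spine t : size (spine t) = lspine t.
Proof. by elim: t => //= l <- r _; rewrite size_rcons. Qed.

Lemma lspine_comb us : lspine (comb us) = size us.
Proof.
rewrite /comb; elim/last_ind: us => //= us u IH.
by rewrite foldl_rcons size_rcons /= IH.
Qed.

Definition forest_code (us : seq btree) : seq nat :=
  flatten [seq lspine u :: code u | u <- us].

Lemma code_comb us : code (comb us) = forest_code us.
Proof.
rewrite /comb /forest_code; elim/last_ind: us => //= us u IH.
by rewrite foldl_rcons map_rcons flatten_rcons /= IH.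
Qed.

(* Reading a degree sequence from right to left, a vertex of degree x adopts
   the x leftmost trees of the forest built so far. *)
Definition decode (s : seq nat) : seq btree :=
  foldr (fun x us => comb (take x us) :: drop x us) [::] s.

Lemma decode_code_cat t s : decode (code t ++ s) = spine t ++ decode s.
Proof.
elim: t s => //= l IHl r IHr s.
rewrite -catA IHl cat_cons /= IHr -size_spine take_size_cat // drop_size_cat //.
by rewrite spineK cat_rcons.
Qed.

Lemma codeK : cancel code (comb \o decode).
Proof. by move=> t /=; rewrite -[code t]cats0 decode_code_cat cats0 spineK. Qed.

Lemma decodeK s : ballot s -> code (comb (decode s)) = s.
Proof.
move=> bs; rewrite code_comb.
(* The second conjunct and the ballot condition ensure that [x] trees are there to adopt, so [take]
   never falls short. *)
suff [] : forest_code (decode s) = s /\ size (decode s) + sumn s = size s by [].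
elim: s bs => //= x s IH /andP[le_x /IH[]] {IH}.
set us := decode s => fus sz_us.
have le_x_us : x <= size us by rewrite -(leq_add2r (sumn s)) sz_us.
rewrite size_drop; split; last by lia.
rewrite /forest_code /= lspine_comb code_comb size_takel //; congr cons.
by rewrite /forest_code -flatten_cat -map_cat cat_take_drop.
Qed.

Lemma code_wedges t i j :
  code (wedges t i j) =
    code (t i) ++ flatten [seq lspine (t m) :: code (t m) | m <- iota i.+1 j].
Proof.
elim: j => [|j IH]; first by rewrite cats0.
by rewrite -[in RHS](addn1 j) iotaD map_cat flatten_cat catA /= IH cats0 addSnnS.
Qed.

Lemma lspine_wedges t i j : lspine (wedges t i j) = lspine (t i) + j.
Proof. by elim: j => [|j IH] /=; rewrite ?addn0 // IH addnS. Qed.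

Lemma nleaves_wedges t i j :
  nleaves (wedges t i j) = nleaves (t i) + \sum_(m <- iota i.+1 j) nleaves (t m).
Proof.
elim: j => [|j IH]; first by rewrite big_nil addn0.
by rewrite -[in RHS](addn1 j) iotaD big_cat big_seq1 addnA addSnnS /= IH.
Qed.

Lemma eq_wedges t t' i j :
  (forall m, m <= i + j -> t m = t' m) -> wedges t i j = wedges t' i j.
Proof.
elim: j => [|j IH] eq_t /=; first by apply: eq_t; rewrite addn0.
by rewrite IH => [|m le_m]; rewrite eq_t // (leq_trans le_m) // addnS.
Qed.

(** * Rotations and residues of degree sequences *)

Section Rotations.

Variable k : nat.

Lemma right_rotation_nleaves s t : right_rotation k s t -> nleaves s = nleaves t.
Proof.
elim=> [u | l l' r _ /= -> | l r r' _ /= ->] //.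
have := nleaves_wedges u 0 k.+1; rewrite /= big_cons => ->.
by rewrite nleaves_wedges.
Qed.

(* At the root of the rotation only the entry in front of [code (t 1)] changes,
   from [lspine (t 1)] to [lspine (t 1) + k]. *)
Lemma right_rotation_code s t : right_rotation k s t ->
  lspine s = lspine t %[mod k] /\
  [seq x %% k | x <- code s] = [seq x %% k | x <- code t].
Proof.
elim=> [u | l l' r _ [eq_l eq_c] | l r r' _ [eq_r eq_c]] /=.
- split; first by rewrite lspine_wedges -addSn modnDr.
  have := code_wedges u 0 k.+1; rewrite /= => ->.
  by rewrite lspine_wedges code_wedges !map_cat /= !map_cat modnDr.
- split; last by rewrite !map_cat eq_c.
  by rewrite -(addn1 (lspine l)) -(addn1 (lspine l')) -modnDml eq_l modnDml.
- by split=> //; rewrite !map_cat /= eq_r eq_c.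
Qed.

(** The total, over all leaves, of the right steps on the path from the root, i.e. the sum of the
    vertex depths in the plane tree. *)
Fixpoint rdepth (t : btree) : nat :=
  if t is Wedge l r then rdepth l + rdepth r + nleaves r else 0.

Lemma rdepth_wedges t i j :
  rdepth (wedges t i j) =
    rdepth (t i) + \sum_(m <- iota i.+1 j) (rdepth (t m) + nleaves (t m)).
Proof.
elim: j => [|j IH]; first by rewrite big_nil addn0.
by rewrite -[in RHS](addn1 j) iotaD big_cat big_seq1 /= IH !addnA addSnnS.
Qed.

(** At the root, exactly the leaves of [u 2], ..., [u k.+1] gain a right step. Hence left rotations
    terminate. *)
Lemma right_rotation_rdepth s t :
  0 < k -> right_rotation k s t -> rdepth s < rdepth t.
Proof.
move=> k_gt0; elim=> [u | l l' r _ IH | l r r' rot_r IH] /=.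
- have := rdepth_wedges u 0 k.+1; rewrite /= => ->.
  rewrite rdepth_wedges nleaves_wedges big_cons.
  suff : 0 < \sum_(m <- iota 2 k) nleaves (u m) by lia.
  by case: k k_gt0 => // k' _; rewrite big_cons; have := nleaves_gt0 (u 2); lia.
- by lia.
- by have := right_rotation_nleaves rot_r; lia.
Qed.

Lemma wedges_of_lspine l r : k <= lspine r ->
  exists t, t 0 = l /\ r = wedges t 1 k.
Proof.
elim: k r => [|j IH] r.
  by move=> _; exists (fun m => if m is 0 then l else r).
case: r => //= r1 r2 /IH[t [t0 ->]].
(* [wedges t 1 j] reads indices up to [j.+1] only, so [j.+2] is free for the last factor. *)
exists (fun m => if m == j.+2 then r2 else t m); split=> //=.
rewrite add1n eqxx; congr (Wedge _ _); apply: eq_wedges => m le_m.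
by case: eqP le_m => // ->; rewrite add1n ltnn.
Qed.

(** A code entry at least [k] is [lspine r] for some node [Wedge l r]; there [r] splits into k+1
    factors, and [l] serves as t_0. *)
Lemma left_rotatable t :
  ~~ all (ltn^~ k) (code t) -> exists s, right_rotation k s t.
Proof.
elim: t => //= l IHl r IHr; rewrite all_cat /= !negb_and.
case/or3P=> [/IHl[s rot_s] | le_k | /IHr[s rot_s]].
- by exists (Wedge s r); apply: RotLeft.
- have [|u [<- ->]] := @wedges_of_lspine l r; first by rewrite leqNgt.
  by exists (Wedge (wedges u 0 k) (u k.+1)); apply: RotRoot.
- by exists (Wedge l s); apply: RotRight.
Qed.

Variable n : nat.
Implicit Types s t : btree_of n.

Lemma rotation_sym : ssrbool.symmetric (@rotation k n).
Proof.
by move=> s t; apply/asboolP/asboolP => -[]; [right | left | right | left].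
Qed.

Lemma k_equivalent_reduced t : 0 < k ->
  exists2 s, k_equivalent k t s & code s = [seq x %% k | x <- code t].
Proof.
move=> k_gt0; have [m] := ubnP (rdepth t); elim: m t => // m IHm t lt_m.
have [/allP lt_k | /left_rotatable[s rot_s]] := boolP (all (ltn^~ k) (code t)).
  exists t; first exact: connect0.
  by rewrite -[LHS]map_id; apply/eq_in_map => x /lt_k lt_x; rewrite modn_small.
have sz_s : nleaves s == n.+1 by rewrite (right_rotation_nleaves rot_s) (valP t).
have [] := IHm (BtreeOf sz_s).
  exact: leq_trans (right_rotation_rdepth k_gt0 rot_s) _.
move=> u eq_u code_u; exists u.
  by apply: connect_trans eq_u; apply/connect1/asboolP; right.
by rewrite code_u; have [] := right_rotation_code rot_s.
Qed.

Lemma k_equivalentP s t : 0 < k ->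
  k_equivalent k s t =
    ([seq x %% k | x <- code s] == [seq x %% k | x <- code t]).
Proof.
move=> k_gt0; apply/idP/eqP => [|eq_st].
  case/connectP=> p; elim: p s => [|u p IH] s /=; first by move=> _ ->.
  case/andP=> /asboolP rot_su /IH{}IH /IH <-.
  by case: rot_su => /right_rotation_code[].
(* The reduced trees of both classes have the same code, hence coincide. *)
have [s' eq_s code_s] := k_equivalent_reduced s k_gt0.
have [t' eq_t code_t] := k_equivalent_reduced t k_gt0.
have eq_st' : s' = t'.
  by apply/val_inj/(can_inj codeK); rewrite code_s code_t.
apply: connect_trans eq_s _; rewrite eq_st' /k_equivalent.
by rewrite (sym_connect_sym rotation_sym).
Qed.

End Rotations.

Local Open Scope ring_scope.

(** * Sums over tuples with bounded entries *)

Lemma big_tuple_cons (V : nmodType) k m (F : seq nat -> V) :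
  \sum_(a : m.+1.-tuple 'I_k) F (map val a) =
    \sum_(i < k) \sum_(a : m.-tuple 'I_k) F (val i :: map val a).
Proof.
rewrite pair_bigA /=.
rewrite (reindex (fun p : 'I_k * m.-tuple 'I_k => [tuple of p.1 :: p.2])) //=.
exists (fun a => (thead a, [tuple of behead a])) => [[i a] _ | a _] /=.
  by congr (_, _); apply: val_inj.
by rewrite -tuple_eta.
Qed.

Lemma big_tuple0 (V : nmodType) k (F : seq nat -> V) :
  \sum_(a : 0.-tuple 'I_k) F (map val a) = F [::].
Proof.
rewrite (bigD1 [tuple]) //= big1 ?addr0 // => a.
by rewrite (tuple0 a) => /eqP.
Qed.

(* Exchangeability of the coordinates of a tuple of given weight. *)
Lemma sum_head_tuple k m (phi : nat -> rat) :
  m.+1%:R * (\sum_(i < k) \sum_(a : m.-tuple 'I_k)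
               i%:R * phi (i + sumn (map val a))%N) =
    \sum_(a : m.+1.-tuple 'I_k)
      (sumn (map val a))%:R * phi (sumn (map val a)).
Proof.
elim: m phi => [|m IHm] phi.
  rewrite mul1r (big_tuple_cons _ _ (fun s => (sumn s)%:R * phi (sumn s))) /=.
  apply: eq_bigr => i _.
  rewrite (big_tuple0 _ (fun s => i%:R * phi (i + sumn s)%N)).
  rewrite (big_tuple0 _ (fun s => (i + sumn s)%:R * phi (i + sumn s)%N)) /=.
  by rewrite addn0.
rewrite (big_tuple_cons _ _ (fun s => (sumn s)%:R * phi (sumn s))) /=.
(* The first entry gives one of [m.+2] equal shares; the others come from the induction hypothesis
   for a shifted [phi]. *)
under [RHS]eq_bigr do under eq_bigr do rewrite natrD mulrDl.
under [RHS]eq_bigr do rewrite big_split /=.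
rewrite big_split /= -natr1 addrC mulrDl mul1r; congr (_ + _).
under [RHS]eq_bigr => i _ do rewrite -(IHm (fun x => phi (i + x)%N)).
rewrite -mulr_sumr; congr (_ * _).
under [LHS]eq_bigr => i _ do
  rewrite (big_tuple_cons _ _ (fun s => i%:R * phi (i + sumn s)%N)) /=.
(* This swaps the first two entries of the tuple. *)
rewrite exchange_big /=; apply: eq_bigr => i _.
apply: eq_bigr => j _; apply: eq_bigr => a _.
by rewrite addnCA.
Qed.

(** A weighted cycle lemma, by removing the first entry: induction handles the tail,
    [sum_head_tuple] averages the entry removed, and the arbitrary [phi] absorbs the shift. *)
Lemma sum_ballot_tuple k m (phi : nat -> rat) :
  m.+1%:R * (\sum_(a : m.+1.-tuple 'I_k | ballot (map val a))
               phi (sumn (map val a))) =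
    \sum_(a : m.+1.-tuple 'I_k)
      (m.+1 - sumn (map val a))%:R * phi (sumn (map val a)).
Proof.
rewrite big_mkcond.
elim: m phi => [|m IHm] phi.
  rewrite mul1r; apply: eq_bigr => a _.
  case: (tupleP a) => x b; rewrite (tuple0 b) /= andbT addn0.
  by case: (val x) => [|y]; rewrite ?mul1r //= subSS sub0n mul0r.
(* The cutoff is the ballot condition at the first entry; it also kills all terms where
   [m.+1 - sumn _] truncates. *)
pose psi s := if (s <= m.+1)%N then phi s else 0.
pose T := \sum_(i < k) \sum_(a : m.+1.-tuple 'I_k | ballot (map val a))
            psi (i + sumn (map val a))%N.
have -> : \sum_(a : m.+2.-tuple 'I_k)
    (if ballot (map val a) then phi (sumn (map val a)) else 0) = T.
  rewrite (big_tuple_cons _ _ (fun s => if ballot s then phi (sumn s) else 0)) /=.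
  apply: eq_bigr => i _; rewrite [RHS]big_mkcond; apply: eq_bigr => a _.
  by rewrite size_map size_tuple /psi; case: leqP; case: ifP.
have m_neq0 : m.+1%:R != 0 :> rat by rewrite pnatr_eq0.
apply: (mulfI m_neq0); rewrite mulrCA /T mulr_sumr.
under eq_bigr => i _ do
  rewrite big_mkcond (IHm (fun x => psi (i + x)%N)).
have -> : \sum_(i < k) \sum_(a : m.+1.-tuple 'I_k)
      (m.+1 - sumn (map val a))%:R * psi (i + sumn (map val a))%N =
    \sum_(a : m.+2.-tuple 'I_k)
      (m.+1%:R - (sumn (map val a))%:R) * psi (sumn (map val a)) +
    \sum_(i < k) \sum_(a : m.+1.-tuple 'I_k)
      i%:R * psi (i + sumn (map val a))%N.
  rewrite (big_tuple_cons _ _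
    (fun s => (m.+1%:R - (sumn s)%:R) * psi (sumn s))) /=.
  rewrite -big_split; apply: eq_bigr => i _.
  rewrite -big_split; apply: eq_bigr => a _ /=.
  rewrite -mulrDl /psi; case: leqP => [le_m | _]; last by rewrite !mulr0.
  by congr (_ * _); rewrite natrB ?natrD; [ring | lia].
rewrite mulrDr sum_head_tuple !mulr_sumr -big_split /=; apply: eq_bigr => a _.
rewrite /psi; case: leqP => [le_m | lt_m].
  by rewrite natrB 1?ltnW // -[m.+2%:R]natr1; ring.
have ->: (m.+2 - sumn (map val a) = 0)%N by apply/eqP; rewrite subn_eq0.
by rewrite mul0r !mulr0 addr0.
Qed.

Lemma card_ballot_tuple k n : (0 < n)%N ->
  #|[set a : n.-tuple 'I_k | ballot (map val a)]|%:R =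
    \sum_(a : n.-tuple 'I_k) (n - sumn (map val a))%:R / n%:R :> rat.
Proof.
case: n => // n _; have := sum_ballot_tuple k n (fun=> 1).
under [in RHS]eq_bigr do rewrite mulr1.
rewrite -mulr_suml => <-.
rewrite [_ * \sum_(i | _) _]mulrC mulfK ?pnatr_eq0 // sumr_const.
by congr (_%:R); apply: eq_card => a; rewrite inE.
Qed.

(* ['C(N + r, r.+1)] is the coefficient of X^(N-1) in (1 - X)^-(r+2), which
   also vanishes when the truncated difference [N] is 0. *)
Lemma sum_bin_tuple k m r N :
  \sum_(a : m.-tuple 'I_k) 'C(N - sumn (map val a) + r, r.+1)%:R =
    \sum_(0 <= j < m.+1)
      (-1) ^+ j * 'C(m, j)%:R * 'C(N - j * k + (r + m), (r + m).+1)%:R :> rat.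
Proof.
elim: m r N => [|m IHm] r N.
  rewrite (big_tuple0 _ (fun s => 'C(N - sumn s + r, r.+1)%:R)).
  by rewrite big_nat1 /= expr0 bin0 !mul1r !subn0 addn0.
(* Hockey-stick identity; where [M - i] truncates to 0 the summand ['C(r, r.+1)] vanishes. *)
have telescope M : \sum_(i < k) 'C(M - i + r, r.+1)%:R =
    'C(M + r.+1, r.+2)%:R - 'C(M - k + r.+1, r.+2)%:R :> rat.
  elim: k {IHm} => [|j IHj]; first by rewrite big_ord0 subn0 subrr.
  rewrite big_ord_recr IHj /= subnS; case: (M - j)%N => [|d] /=.
    by rewrite (bin_small (ltnSn r)) addr0.
  by rewrite addSn binS natrD addSnnS; ring.
rewrite (big_tuple_cons _ _ (fun s => 'C(N - sumn s + r, r.+1)%:R)).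
rewrite exchange_big /=.
under eq_bigr do under eq_bigr do rewrite [(_ + sumn _)%N]addnC subnDA.
under eq_bigr do rewrite telescope subnAC.
rewrite sumrB !IHm -addSnnS.
rewrite [in RHS]big_nat_recl // [X in X - _]big_nat_recl //=.
rewrite expr0 !bin0 mul0n subn0 -addrA; congr (_ + _).
(* A zero term with ['C(m, m.+1)] aligns the two ranges for Pascal's rule. *)
have -> : \sum_(0 <= i < m) (-1) ^+ i.+1 * 'C(m, i.+1)%:R *
    'C(N - i.+1 * k + (r.+1 + m), (r.+1 + m).+1)%:R =
  \sum_(0 <= i < m.+1) (-1) ^+ i.+1 * 'C(m, i.+1)%:R *
    'C(N - i.+1 * k + (r.+1 + m), (r.+1 + m).+1)%:R :> rat.
  by rewrite big_nat_recr //= bin_small // mulr0 mul0r addr0.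
rewrite -sumrB; apply: eq_bigr => j _.
by rewrite binS natrD exprS -subnDA mulSn; ring.
Qed.

(** * Counting classes and grouping by partitions *)

Lemma card_equivalence_partition (T rT : finType) (R : rel T) (f : T -> rT) :
    (forall x y, R x y = (f x == f y)) ->
  #|equivalence_partition R [set: T]| = #|f @: [set: T]|.
Proof.
move=> Rf.
have -> : equivalence_partition R [set: T] =
    (fun v => [set y | v == f y]) @: (f @: [set: T]).
  rewrite -imset_comp; apply: eq_imset => x /=.
  by apply/setP=> y; rewrite !inE Rf.
rewrite card_in_imset // => _ _ /imsetP[x _ ->] /imsetP[y _ ->] /setP/(_ x).
by rewrite !inE eqxx => /esym/eqP.
Qed.

(** The residues of the code separate the classes, and every ballot tuple is attained by the tree
    decoded from it. *)
Lemma modular_catalan_ballot k n : (0 < k)%N ->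
  modular_catalan k n = #|[set a : n.-tuple 'I_k | ballot (map val a)]|.
Proof.
move=> k_gt0; pose red x : 'I_k := Ordinal (ltn_pmod x k_gt0).
have sz_red (t : btree_of n) : size (map red (code t)) == n.
  by rewrite size_map -eqSS size_code (valP t).
pose f t := Tuple (sz_red t).
have val_f t : map val (f t) = [seq (x %% k)%N | x <- code t].
  by rewrite /= -map_comp.
rewrite /modular_catalan (@card_equivalence_partition _ _ _ f); last first.
  move=> s t; rewrite k_equivalentP // -!val_f.
  by apply/eqP/eqP => [/(inj_map val_inj)/val_inj | ->].
congr #|pred_of_set _|; apply/setP=> a; rewrite inE.
apply/imsetP/idP => [[t _ ->] | ballot_a].
  by rewrite val_f ballot_modn ?ballot_code.
have sz_t : nleaves (comb (decode (map val a))) == n.+1.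
  by rewrite -size_code decodeK // size_map size_tuple.
exists (BtreeOf sz_t) => //; apply/val_inj/(inj_map val_inj).
rewrite val_f /= decodeK // -map_comp; apply: eq_map => i /=.
by rewrite modn_small.
Qed.

Lemma part_sizeE k n (a : n.-tuple 'I_k) : part_size a = sumn (map val a).
Proof. by rewrite sumnE big_map big_tuple. Qed.

Lemma monomial_sym_ones_sum k n (lam : n.-tuple 'I_k) :
  monomial_sym_ones lam = \sum_(a : n.-tuple 'I_k | perm_eq a lam) 1.
Proof.
rewrite /monomial_sym_ones /monomial_sym rmorph_sum; apply: eq_bigr => a _ /=.
by rewrite mevalX big1 // => i _; rewrite expr1n.
Qed.

(** Tuples are grouped by their decreasing rearrangement; the fibre over [lam] has
    [monomial_sym_ones lam] elements. *)
Lemma sum_monomial_sym_ones k n (phi : nat -> rat) :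
  \sum_(lam : n.-tuple 'I_k | is_partition lam && (part_size lam < n)%N)
     phi (part_size lam) * monomial_sym_ones lam =
  \sum_(a : n.-tuple 'I_k | (sumn (map val a) < n)%N) phi (sumn (map val a)).
Proof.
pose geo : rel 'I_k := relpre val geq.
have geo_total : total geo by move=> x y; apply: leq_total.
have geo_trans : transitive geo by move=> y x z /= xy yz; apply: leq_trans xy.
have geo_anti : antisymmetric geo.
  by move=> x y /= le_yx; apply/val_inj/anti_leq; rewrite andbC.
have partE (lam : n.-tuple 'I_k) : is_partition lam = sorted geo lam.
  by rewrite /is_partition sorted_map.
have part_size_perm (a b : n.-tuple 'I_k) :
    perm_eq a b -> part_size a = part_size b.
  by move=> ab; rewrite !part_sizeE; apply/perm_sumn/perm_map.
have perm_sort_tuple (a : n.-tuple 'I_k) : perm_eq a (sort_tuple geo a).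
  by rewrite perm_sym /= perm_sort.
under [RHS]eq_bigl do rewrite -part_sizeE.
under [RHS]eq_bigr do rewrite -part_sizeE.
rewrite [RHS](partition_big (sort_tuple geo)
  (fun lam => is_partition lam && (part_size lam < n)%N)) /=; last first.
  move=> a lt_a; rewrite partE sort_sorted //.
  by rewrite -(part_size_perm _ _ (perm_sort_tuple a)).
apply: eq_bigr => lam /andP[part_lam lt_lam].
rewrite monomial_sym_ones_sum mulr_sumr.
have eq_sort (a : n.-tuple 'I_k) : perm_eq a lam = (sort_tuple geo a == lam).
  apply/idP/eqP => [a_lam | <-]; last exact: perm_sort_tuple.
  apply: val_inj => /=; apply: (@sorted_eq _ geo) => //; first exact: sort_sorted.
    by rewrite -partE.
  by rewrite perm_sort.
apply: eq_big => [a | a a_lam].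
  rewrite eq_sort; case: eqP => [eq_a | _]; rewrite ?andbF // andbT.
  by rewrite (part_size_perm a lam) // eq_sort eq_a.
by rewrite mulr1 (part_size_perm a lam).
Qed.

Theorem theorem1p1 (k n : nat) (hk : (1 <= k)%N) (hn : (1 <= n)%N) :
  (modular_catalan k n)%:R =
    \sum_(lam : n.-tuple 'I_k | is_partition lam && (part_size lam < n)%N)
       (n%:R - (part_size lam)%:R) / n%:R * monomial_sym_ones lam :> rat
  /\
  \sum_(lam : n.-tuple 'I_k | is_partition lam && (part_size lam < n)%N)
     (n%:R - (part_size lam)%:R) / n%:R * monomial_sym_ones lam
  = \sum_(0 <= j < ((n - 1) %/ k).+1)
       (-1) ^+ j / n%:R * 'C(n, j)%:R * 'C(2 * n - j * k, n + 1)%:R :> rat.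
Proof.
rewrite (sum_monomial_sym_ones k n (fun s => (n%:R - s%:R) / n%:R)).
have -> : \sum_(a : n.-tuple 'I_k | (sumn (map val a) < n)%N)
    (n%:R - (sumn (map val a))%:R) / n%:R =
  \sum_(a : n.-tuple 'I_k) (n - sumn (map val a))%:R / n%:R :> rat.
  rewrite big_mkcond; apply: eq_bigr => a _.
  case: ltnP => [lt_a | le_a]; first by rewrite natrB // ltnW.
  by move: le_a; rewrite -subn_eq0 => /eqP ->; rewrite mul0r.
split; first by rewrite modular_catalan_ballot // card_ballot_tuple.
rewrite -mulr_suml.
(* For [r = 0] the summand ['C(x, 1)] is the truncated difference itself. *)
have := sum_bin_tuple k n 0 n; rewrite add0n.
under eq_bigr do rewrite addn0 bin1.
move=> ->; rewrite (@big_cat_nat _ _ _ ((n - 1) %/ k).+1) //=; last first.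
  by rewrite ltnS (leq_trans (leq_div _ _)) // leq_subr.
(* Past (n-1)/k one has [n <= j * k], so the last binomial is ['C(n, n.+1)], which is 0. *)
rewrite [X in _ + X]big_nat_cond [X in _ + X]big1 => [|j]; last first.
  rewrite andbT => /andP[lt_j _].
  have le_n : (n <= j * k)%N.
    by move: lt_j; rewrite ltn_divLR //; lia.
  have -> : (n - j * k = 0)%N by lia.
  by rewrite (bin_small (ltnSn n)) mulr0.
rewrite addr0 mulr_suml [LHS]big_nat [RHS]big_nat; apply: eq_bigr => j /andP[_].
rewrite ltnS leq_divRL // => le_j.
have -> : (n - j * k + n = 2 * n - j * k)%N by lia.
by rewrite addn1; ring.
Qed.
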